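(* Let $N\ge 2$, $d\ge1$ be integers and $\tau>0$. Consider the system with reaction-type delay $$\dot x_i(t)=\sum_{j\neq i}\psi_{ij}(t)\,\bigl(x_j(t-\tau)-x_i(t-\tau)\bigr),\qquad i\in[N],\ t>0,$$ with initial datum $x_i(t)=x_i^0(t)$ for $t\in[-\tau,0]$, where $x_i^0:[-\tau,0]\to\mathbb{R}^d$ are prescribed continuous functions. Assume that the communication weights satisfy, for all $t\ge0$ and all $i\neq j$ in $[N]$, the bound $\psi_{ij}(t)\le\frac{1}{N-1}$ and the symmetry $\psi_{ij}(t)=\psi_{ji}(t)$, and that they have the global positivity property: for every $R>0$ there exists $\underline\psi=\underline\psi(R)>0$ such that for every $T>0$, if $|x_i(t)-x_j(t)|\le R$ for all $t\in[-\tau,T]$ and all $i,j\in[N]$, then $\psi_{ij}(t)\ge\frac{\underline\psi}{N-1}$ for all $t\in[0,T]$ and all $i\ne j$ in $[N]$. If $\tau\le 1/2$, then every solution reaches global asymptotic consensus, i.e. $$\lim_{t\to\infty}d_x(t)=0,\qquad d_x(t):=\max_{i,j\in[N]}|x_i(t)-x_j(t)|.$$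
   Context: $[N]:=\{1,\dots,N\}$ and $|\cdot|$ is the Euclidean norm. A solution consists of continuous functions $x_i:[-\tau,\infty)\to\mathbb{R}^d$, continuously differentiable on $[0,\infty)$, satisfying the system and the initial condition. The communication weights $\psi_{ij}=\psi_{ij}(t)\ge0$ ($i\neq j$) may depend on the history of the trajectories; no particular expression is fixed, and the hypotheses are imposed on the resulting functions of time along the solution considered. Standing assumption: all $\psi_{ij}$ are continuous functions of time $t\ge 0$. *)

(* Defs.v *)
From HB Require Import structures.
From mathcomp Require Import all_boot all_order all_algebra.
From mathcomp Require Import all_classical all_reals all_analysis.

Set Implicit Arguments.
Unset Strict Implicit.
Unset Printing Implicit Defensive.

Import Order.TTheory GRing.Theory Num.Theory.
Import numFieldNormedType.Exports.

Local Open Scope classical_set_scope.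
Local Open Scope ring_scope.

(* The library norm on ['rV[R]_d] is the sup norm; it induces the same topology
   (hence the same continuity and derivatives) as the Euclidean norm, but
   distances between agents have to be measured with the latter. *)
Definition enorm (R : realType) (d : nat) (v : 'rV[R]_d) : R :=
  Num.sqrt (\sum_(k < d) v ord0 k ^+ 2).

(* Continuously differentiable on [0, +oo): two-sided derivative for [t > 0],
   right derivative at 0, and a derivative continuous up to 0. *)
Definition C1_nonneg (R : realType) (d : nat) (f : R -> 'rV[R]_d) : Prop :=
  exists f' : R -> 'rV[R]_d,
    [/\ {within `[0, +oo[, continuous f'},
        (forall t : R, 0 < t -> is_derive t 1 f (f' t)) &
        h^-1 *: (f h - f 0) @[h --> 0^'+] --> f' 0].

(* Trajectories are total functions on [R]; only their values on [-tau, +oo)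
   are constrained or used.  The weights are functions of time along the
   solution, and the diagonal entries [psi i i] play no role. *)
Definition is_solution (R : realType) (N d : nat) (tau : R)
    (psi : 'I_N -> 'I_N -> R -> R) (x0 x : 'I_N -> R -> 'rV[R]_d) : Prop :=
  [/\ (forall i, {within `[- tau, +oo[, continuous (x i)}),
      (forall i, C1_nonneg (x i)),
      (forall i (t : R), 0 < t ->
         is_derive t 1 (x i)
           (\sum_(j < N | j != i)
              psi i j t *: (x j (t - tau) - x i (t - tau)))) &
      (forall i (t : R), - tau <= t <= 0 -> x i t = x0 i t)].

Definition globally_positive (R : realType) (N d : nat) (tau : R)
    (psi : 'I_N -> 'I_N -> R -> R) (x : 'I_N -> R -> 'rV[R]_d) : Prop :=
  forall r : R, 0 < r -> exists2 psi_ : R, 0 < psi_ &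
    forall T : R, 0 < T ->
      (forall (t : R) (i j : 'I_N), - tau <= t <= T ->
         enorm (x i t - x j t) <= r) ->
      forall (t : R) (i j : 'I_N), 0 <= t <= T -> i != j ->
        psi_ / (N%:R - 1) <= psi i j t.

(* Since distances are nonnegative, the default value 0 of the iterated maximum
   does not affect the result when [N > 0]. *)
Definition diameter (R : realType) (N d : nat) (x : 'I_N -> R -> 'rV[R]_d)
    (t : R) : R :=
  \big[Num.max/0]_(i < N) \big[Num.max/0]_(j < N) enorm (x i t - x j t).

(* Main.v *)
Require Import Defs.
From mathcomp Require Import all_boot all_order all_algebra.
From mathcomp Require Import all_classical all_reals all_analysis.
From mathcomp Require Import ring lra.
Set Implicit Arguments.
Unset Strict Implicit.
Unset Printing Implicit Defensive.
Import Order.TTheory GRing.Theory Num.Theory.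
Import numFieldNormedType.Exports.
Local Open Scope classical_set_scope.
Local Open Scope ring_scope.

(** The weights are the same for all coordinates of the agents, so each family
of k-th coordinates solves the same scalar system, and it is enough to treat
real-valued trajectories [y i] with velocities [v i].

Energy.  Symmetry and the bound on the weights make the graph Laplacian [L(t)]
satisfy [|L a|^2 <= 2 <a, L a>] ([drift_dissipation]).  Writing
[y(t) = y(t-tau) + z(t)] with [z(t) = y(t) - y(t-tau)], the derivative of
[|y|^2 / 2] is at most [- |v|^2 / 2 + <z, v>], and by Cauchy-Schwarz
[<z, v> <= tau |v|^2 / 2 + (int_(t-tau)^t |v|^2) / 2 - |r|^2 / (2 tau)]
where [r = tau v - z].  Adding to [|y|^2 / 2] the usual double integral of
[|v|^2] over the delay window gives an energy with derivative at most
[- (1/2 - tau) |v|^2 - |r|^2 / (2 tau)] ([energy_exists]).  The first term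
vanishes when [tau = 1/2], and then it is the remainder [r] kept from
Cauchy-Schwarz that drives the convergence.  The energy bounds the trajectories,
so the global positivity property yields a positive lower bound on the weights
that is valid for all times.

Delay windows.  The remainder [r] is the derivative of the defect
[I(t) = tau y(t) - int_(t-tau)^t y], and [I] is itself the derivative of a
bounded function.  Since [r] is square integrable, [I] varies by little over any
long window far away in time, while its integral over the window stays bounded:
hence [I] tends to 0 ([dissipated_rate_le], [window_mean_defect_le]).  So each
[y i(t)] is asymptotically the mean of [y i] over the preceding delay window.

Maximum principle.  Let [M] be the limit superior of the largest [y i].  When
[y i(t)] is almost [M], so is [y i] on average over [[t-tau, t]], and, restarting
from a suitable time of that window, over [[t-3tau/2, t-tau]] as well.
If [M] were larger than the conserved mean of the agents, the others would pull
[y i] down at a definite rate on [[t-tau/2, t]], which is impossible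
([eventually_le_mean]).  Hence [M] is at most the mean; applying this to [- y]
shows that all [y i] converge to the mean. *)

(** * Calculus on the real line *)

Lemma is_derive_cont (R : realType) (f : R -> R) (t df : R) :
  is_derive t 1 f df -> {for t, continuous f}.
Proof. by move=> [df1 _]; apply/differentiable_continuous/derivable1_diffP. Qed.

Lemma MVT_closed (R : realType) (f df : R -> R) (p q : R) :
  p < q -> (forall t, p <= t <= q -> is_derive t 1 f (df t)) ->
  exists2 c, p < c < q & f q - f p = df c * (q - p).
Proof.
move=> pq fdf.
have fdf' t : t \in `]p, q[ -> is_derive t 1 f (df t).
  by rewrite in_itv/= => /andP[? ?]; apply: fdf; rewrite !ltW.
have [|c cpq fE] := MVT pq fdf'; last by exists c => //; rewrite in_itv/= in cpq.
apply: continuous_in_subspaceT => t; rewrite inE/= in_itv/= => tpq.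
exact: is_derive_cont (fdf _ tpq).
Qed.

Lemma derive_ge0_le (R : realType) (f df : R -> R) (p q : R) :
  p <= q -> (forall t, p <= t <= q -> is_derive t 1 f (df t)) ->
  (forall t, p <= t <= q -> 0 <= df t) -> f p <= f q.
Proof.
rewrite le_eqVlt => /predU1P[-> //|pq] fdf df0.
have [c /andP[pc cq] fE] := MVT_closed pq fdf.
rewrite -subr_ge0 fE; apply: mulr_ge0; last by rewrite subr_ge0 ltW.
by apply: df0; rewrite !ltW.
Qed.

Lemma derive_le0_ge (R : realType) (f df : R -> R) (p q : R) :
  p <= q -> (forall t, p <= t <= q -> is_derive t 1 f (df t)) ->
  (forall t, p <= t <= q -> df t <= 0) -> f q <= f p.
Proof.
move=> pq fdf df0; rewrite -lerN2.
apply: (@derive_ge0_le _ (- f) (- df) p q) => // t tpq.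
  by have := fdf _ tpq => ?; apply: is_deriveN.
by rewrite /= oppr_ge0 df0.
Qed.

Lemma primitive_exists (R : realType) (f : R -> R) (a b : R) : a < b ->
  (forall t, a < t -> {for t, continuous f}) ->
  exists F : R -> R, forall t, b < t -> is_derive t 1 F (f t).
Proof.
move=> ab cf; exists (fun t => (\int[lebesgue_measure]_(s in `[b, t]) f s)%R) => t bt.
have intf : (@lebesgue_measure R).-integrable `[b, t + 1] (EFin \o f).
  apply: continuous_compact_integrable; first exact: segment_compact.
  apply: continuous_in_subspaceT => s; rewrite inE/= in_itv/= => /andP[bs _].
  by apply: cf; exact: lt_le_trans bs.
have tt1 : t < t + 1 by rewrite ltrDl.
have [|dF Ft] := continuous_FTC1 tt1 intf _ (cf _ (lt_trans ab bt)).
  by rewrite /= lte_fin.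
by rewrite derive1E in Ft; exact: (DeriveDef dF Ft).
Qed.

(** The differentiation rules below are stated for functions given pointwise,
so that they compose as terms, with the derivative read off from the term. *)
Section PointwiseDerivatives.
Variable R : realType.
Implicit Types (f g : R -> R) (t c a b : R).

Lemma is_derive_addf f g t a b : is_derive t 1 f a -> is_derive t 1 g b ->
  is_derive t 1 (fun s => f s + g s) (a + b).
Proof. by move=> fa gb; apply: is_deriveD. Qed.

Lemma is_derive_subf f g t a b : is_derive t 1 f a -> is_derive t 1 g b ->
  is_derive t 1 (fun s => f s - g s) (a - b).
Proof. by move=> fa gb; apply: is_deriveB. Qed.

Lemma is_derive_scalef c f t a : is_derive t 1 f a ->
  is_derive t 1 (fun s => c * f s) (c * a).
Proof. by move=> fa; apply: (@is_deriveZ R R R f c t 1 a). Qed.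

Lemma is_derive_sqrf f t a : is_derive t 1 f a ->
  is_derive t 1 (fun s => f s ^+ 2) (2 * f t * a).
Proof. by move=> fa; apply: (@is_deriveX R R f 2 t 1 a). Qed.

Lemma is_derive_sumf n (h : 'I_n -> R -> R) t (a : 'I_n -> R) :
  (forall i, is_derive t 1 (h i) (a i)) ->
  is_derive t 1 (fun s => \sum_(i < n) h i s) (\sum_(i < n) a i).
Proof.
move=> ha; have := is_derive_sum ha; congr is_derive.
by apply/funext => s; rewrite fct_sumE.
Qed.

Lemma is_derive_shiftf f t c a : is_derive (t - c) 1 f a ->
  is_derive t 1 (fun s => f (s - c)) a.
Proof.
move=> fa.
have gd : is_derive t 1 (fun s : R => s - c) (1 : R).
  by rewrite -[X in is_derive _ _ _ X](subr0 1); apply: is_deriveB.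
by rewrite -[a]mulr1; apply: (@is_derive1_comp _ f (fun s => s - c)).
Qed.

Lemma is_derive_idf t : is_derive t 1 (fun s : R => s) 1.
Proof. exact: is_derive_id. Qed.

End PointwiseDerivatives.

(** Cauchy-Schwarz for the integral of [df], without integrals: for the mean
slope [c] of [f], the function [G - 2 c f + c^2 id] has derivative at least
[(df - c)^2 >= 0], and its increment is the difference of the two sides divided
by [q - p]. *)
Lemma sqr_increment_le (R : realType) (f df G g : R -> R) (p q : R) : p <= q ->
  (forall t, p <= t <= q -> is_derive t 1 f (df t)) ->
  (forall t, p <= t <= q -> is_derive t 1 G (g t)) ->
  (forall t, p <= t <= q -> df t ^+ 2 <= g t) ->
  (f q - f p) ^+ 2 <= (q - p) * (G q - G p).
Proof.
rewrite le_eqVlt => /predU1P[-> *|pq fd Gd dfg]; first by rewrite !subrr expr0n mul0r.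
pose c := (f q - f p) / (q - p).
have qp0 : 0 < q - p by rewrite subr_gt0.
have H : G p - 2 * c * f p + c ^+ 2 * p <= G q - 2 * c * f q + c ^+ 2 * q.
  apply: (@derive_ge0_le _ (fun s => G s - 2 * c * f s + c ^+ 2 * s)
    (fun s => g s - 2 * c * df s + c ^+ 2 * 1) _ _ (ltW pq)) => t tpq.
    by exact: (is_derive_addf (is_derive_subf (Gd _ tpq)
      (is_derive_scalef _ (fd _ tpq))) (is_derive_scalef _ (is_derive_idf _))).
  by have := dfg _ tpq; have := sqr_ge0 (df t - c); lra.
have fE : f q = f p + c * (q - p) by rewrite /c divfK ?gt_eqF//; lra.
move: H; rewrite fE => H.
have {H} : c ^+ 2 * (q - p) <= G q - G p by lra.
by rewrite -(ler_pM2l qp0); lra.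
Qed.

(** * Convergence from dissipation *)

Lemma nonincreasing_tail (R : realType) (E : R -> R) (a : R) :
  (forall s t, a < s -> s <= t -> E t <= E s) -> (forall t, a < t -> 0 <= E t) ->
  forall eta, 0 < eta -> exists2 T, a < T & forall t, T <= t -> E T - E t <= eta.
Proof.
move=> Em E0 eta eta0.
have [|_ [T /= aT <-] ET] := @inf_adherent R (E @` [set t | a < t]) eta eta0.
  split; first by exists (E (a + 1)); exists (a + 1) => //=; rewrite ltrDl.
  by exists 0 => _ [t /= ta <-]; exact: E0.
exists T => // t Tt.
have : inf (E @` [set t | a < t]) <= E t.
  apply: ge_inf; first by exists 0 => _ [s /= sa <-]; exact: E0.
  by exists t => //=; exact: lt_le_trans Tt.
by move: ET; lra.
Qed.

(** A form of Barbalat's lemma with [r = I'] only square integrable in time, as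
witnessed by the energy [E].  By [sqr_increment_le], [I] is nearly constant over
windows of fixed length [h] once [E] has almost stopped decreasing; were it
still above [eps], its primitive [J] would grow by [h * eps / 2], more than the
bound on [J] allows for the chosen [h]. *)
Lemma dissipated_rate_le (R : realType) (J I r E e : R -> R) (a c B : R) :
  0 < c ->
  (forall t, a < t -> is_derive t 1 J (I t)) ->
  (forall t, a < t -> is_derive t 1 I (r t)) ->
  (forall t, a < t -> is_derive t 1 E (e t)) ->
  (forall t, a < t -> c * r t ^+ 2 <= - e t) ->
  (forall t, a < t -> 0 <= E t) ->
  (forall t, a < t -> `|J t| <= B) ->
  forall eps, 0 < eps -> exists2 T, a < T & forall t, T <= t -> I t <= eps.
Proof.
move=> c0 Jd Id Ed re E0 JB eps eps0.
have B0 : 0 <= B by apply: le_trans (JB (a + 1) _); rewrite ?ltrDl.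
(* The window length for which [h * eps / 2 = 2 * B + 1 / 2]. *)
pose h := (4 * B + 1) / eps.
have h0 : 0 < h by rewrite divr_gt0//; lra.
have Em s t : a < s -> s <= t -> E t <= E s.
  move=> sa st; apply: (@derive_le0_ge _ _ e) => // u /andP[su _].
    by apply: Ed; exact: lt_le_trans su.
  have := re u (lt_le_trans sa su).
  by have := mulr_ge0 (ltW c0) (sqr_ge0 (r u)); lra.
have h4 : 0 < 4 * h := mulr_gt0 (ltr0Sn _ 3) h0.
have eta0 : 0 < c * eps ^+ 2 / (4 * h).
  by apply: divr_gt0 => //; apply: mulr_gt0 => //; apply: exprn_gt0.
have [T aT ET] := nonincreasing_tail Em E0 eta0.
exists T => // t Tt; rewrite leNgt; apply/negP => It.
have at_ : a < t by exact: lt_le_trans Tt.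
have Ige s : t <= s <= t + h -> eps / 2 <= I s.
  move=> /andP[ts sh].
  have := @sqr_increment_le _ I r (fun u => - c^-1 * E u) (fun u => - c^-1 * e u) t s ts.
  move=> H; have {H} : (I s - I t) ^+ 2 <= (s - t) * (- c^-1 * E s - - c^-1 * E t).
    apply: H => u /andP[tu _]; have au := lt_le_trans at_ tu.
    - exact: Id.
    - by exact: (is_derive_scalef _ (Ed _ au)).
    - by rewrite mulNr -mulrN mulrC ler_pdivlMr// mulrC; exact: re.
  have -> : - c^-1 * E s - - c^-1 * E t = (E t - E s) / c by lra.
  have Ets0 : 0 <= E t - E s by rewrite subr_ge0; exact: Em.
  have Ets : E t - E s <= c * eps ^+ 2 / (4 * h).
    have := ET s (le_trans Tt ts); have := Em T t aT Tt; lra.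
  have : (s - t) * ((E t - E s) / c) <= h * (c * eps ^+ 2 / (4 * h) / c).
    apply: ler_pM; rewrite ?subr_ge0//; first by rewrite divr_ge0// ltW.
      by rewrite lerBlDl.
    by rewrite ler_pM2r ?invr_gt0.
  have -> : h * (c * eps ^+ 2 / (4 * h) / c) = (eps / 2) ^+ 2.
    by field; rewrite !gt_eqF.
  move=> H1 H2; have : (I s - I t) ^+ 2 <= (eps / 2) ^+ 2 by exact: le_trans H1.
  rewrite leNgt => {}H1; rewrite leNgt; apply: contra H1 => Is.
  have := @mulr_gt0 _ (I t - I s - eps / 2) (I t - I s + eps / 2).
  by rewrite !subr_gt0 => /(_ ltac:(lra) ltac:(lra)); lra.
have : J t - eps / 2 * t <= J (t + h) - eps / 2 * (t + h).
  apply: (@derive_ge0_le _ (fun s => J s - eps / 2 * s) (fun s => I s - eps / 2 * 1)).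
  - by rewrite lerDl ltW.
  - move=> s /andP[ts _]; exact: (is_derive_subf (Jd _ (lt_le_trans at_ ts))
      (is_derive_scalef _ (is_derive_idf _))).
  - by move=> s sth; have := Ige _ sth; lra.
have -> : eps / 2 * (t + h) = eps / 2 * t + (2 * B + 1 / 2).
  by rewrite /h; field; rewrite gt_eqF.
have := JB _ at_; have := JB (t + h) (ltr_wpDr (ltW h0) at_).
by rewrite !ler_norml; lra.
Qed.

(** The defect is the derivative of [tau Y - (Z - Z(. - tau))] with [Z' = Y],
which is the integral of [Y(t) - Y(s)] for [s] in the delay window, hence
bounded as [Y] is Lipschitz; and its own derivative is the dissipated
quantity. *)
Lemma window_mean_defect_le (R : realType) (y Y v E e : R -> R) (tau b c B : R) :
  0 < tau -> 0 < c ->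
  (forall t, b < t -> is_derive t 1 y (v t)) ->
  (forall t, b < t -> is_derive t 1 Y (y t)) ->
  (forall t, b < t -> `|y t| <= B) ->
  (forall t, b + tau < t -> is_derive t 1 E (e t)) ->
  (forall t, b + tau < t -> 0 <= E t) ->
  (forall t, b + tau < t -> c * (tau * v t - (y t - y (t - tau))) ^+ 2 <= - e t) ->
  forall eps, 0 < eps -> exists2 T, b < T &
    forall t, T <= t -> tau * y t - (Y t - Y (t - tau)) <= eps.
Proof.
move=> tau0 c0 yd Yd yB Ed E0 re eps eps0.
have bt : b < b + tau by rewrite ltrDl.
have [Z Zd] := primitive_exists bt (fun t bt => is_derive_cont (Yd t bt)).
have B0 : 0 <= B by apply: le_trans (yB (b + 1) _); rewrite ?ltrDl.
pose I t := tau * y t - (Y t - Y (t - tau)).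
pose J t := tau * Y t - (Z t - Z (t - tau)).
pose r t := tau * v t - (y t - y (t - tau)).
have Jd t : b + 2 * tau < t -> is_derive t 1 J (I t).
  move=> tb; have [t1 t2 t3] : [/\ b < t, b + tau < t & b + tau < t - tau] by split; lra.
  exact: (is_derive_subf (is_derive_scalef _ (Yd _ t1))
    (is_derive_subf (Zd _ t2) (is_derive_shiftf (Zd _ t3)))).
have Id t : b + 2 * tau < t -> is_derive t 1 I (r t).
  move=> tb; have [t1 t2] : b < t /\ b < t - tau by split; lra.
  exact: (is_derive_subf (is_derive_scalef _ (yd _ t1))
    (is_derive_subf (Yd _ t1) (is_derive_shiftf (Yd _ t2)))).
have JB t : b + 2 * tau < t -> `|J t| <= tau * (B * tau).
  move=> tb; have Y_lip s : t - tau <= s <= t -> `|Y t - Y s| <= B * tau.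
    move=> /andP[ts]; rewrite le_eqVlt => /predU1P[->|st].
      by rewrite subrr normr0 mulr_ge0// ltW.
    have Yd' u : s <= u <= t -> is_derive u 1 Y (y u).
      by move=> /andP[su _]; apply: Yd; lra.
    have [x /andP[sx xt] ->] := MVT_closed st Yd'.
    rewrite normrM ler_pM//; first by apply: yB; lra.
    by rewrite ger0_norm; lra.
  have Zd' u : t - tau <= u <= t -> is_derive u 1 Z (Y u).
    by move=> /andP[tu _]; apply: Zd; lra.
  have tt : t - tau < t by lra.
  have [x /andP[sx xt] ZE] := MVT_closed tt Zd'.
  have -> : J t = tau * (Y t - Y x) by rewrite /J ZE; ring.
  by rewrite normrM gtr0_norm// ler_pM2l//; apply: Y_lip; lra.
have Ed' t : b + 2 * tau < t -> is_derive t 1 E (e t) by move=> tb; apply: Ed; lra.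
have E0' t : b + 2 * tau < t -> 0 <= E t by move=> tb; apply: E0; lra.
have re' t : b + 2 * tau < t -> c * r t ^+ 2 <= - e t by move=> tb; apply: re; lra.
have [T bT H] := dissipated_rate_le c0 Jd Id Ed' re' E0' JB eps0.
by exists T => //; lra.
Qed.

(** * Dissipation by symmetric weights *)

Section WeightMatrix.
Variables (R : realType) (N : nat) (psi : 'I_N -> 'I_N -> R).
Hypothesis N2 : (2 <= N)%N.
Hypothesis psi_ge0 : forall i j, i != j -> 0 <= psi i j.
Hypothesis psi_le : forall i j, i != j -> psi i j <= 1 / (N%:R - 1).
Hypothesis psi_sym : forall i j, i != j -> psi i j = psi j i.

Lemma weight_sum_le1 i : \sum_(j < N | j != i) psi i j <= 1.
Proof.
have N1 : (0 : R) < N%:R - 1 by rewrite subr_gt0 ltr1n.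
apply: (@le_trans _ _ (\sum_(j < N | j != i) 1 / (N%:R - 1))).
  by apply: ler_sum => j ji; apply: psi_le; rewrite eq_sym.
rewrite sumr_const; have -> : #|[pred j | j != i]| = N.-1.
  by have := cardC1 i; rewrite card_ord => <-; apply: eq_card => j; rewrite !inE.
rewrite -[X in X <= _]mulr_natr; have -> : N.-1%:R = N%:R - 1 :> R.
  by rewrite -subn1 natrB// ltnW.
by rewrite div1r mulVf// gt_eqF.
Qed.

(** The diagonal term vanishes whatever the diagonal weight is, which makes the
double sums below rectangular and their indices exchangeable. *)
Lemma drift_uncond (a : 'I_N -> R) i :
  \sum_(j < N | j != i) psi i j * (a j - a i) = \sum_(j < N) psi i j * (a j - a i).
Proof. by rewrite [RHS](bigD1 i)//= subrr mulr0 add0r. Qed.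

(** Jensen's inequality for weights of total mass at most 1, from the
nonnegativity of the weighted sum of [(a j - a i - s)^2] with [s] the drift. *)
Lemma sqr_drift_le (a : 'I_N -> R) i :
  (\sum_(j < N | j != i) psi i j * (a j - a i)) ^+ 2 <=
  \sum_(j < N | j != i) psi i j * (a j - a i) ^+ 2.
Proof.
set s := \sum_(j < N | _) _.
have : 0 <= \sum_(j < N | j != i) psi i j * (a j - a i - s) ^+ 2.
  by apply: sumr_ge0 => j ji; rewrite mulr_ge0 ?sqr_ge0// psi_ge0// eq_sym.
have -> : \sum_(j < N | j != i) psi i j * (a j - a i - s) ^+ 2 =
    \sum_(j < N | j != i) psi i j * (a j - a i) ^+ 2 - 2 * s * s +
    s ^+ 2 * \sum_(j < N | j != i) psi i j.
  have -> : 2 * s * s = \sum_(j < N | j != i) 2 * s * (psi i j * (a j - a i)).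
    by rewrite -mulr_sumr.
  rewrite [s ^+ 2 * _]mulr_sumr -sumrB -big_split/=.
  by apply: eq_bigr => j _; ring.
have := ler_wpM2l (sqr_ge0 s) (weight_sum_le1 i); lra.
Qed.

Lemma weight_symT i j : psi i j = psi j i.
Proof. by have [->//|] := eqVneq i j; exact: psi_sym. Qed.

Lemma sum_drift_eq0 (a : 'I_N -> R) :
  \sum_(i < N) \sum_(j < N | j != i) psi i j * (a j - a i) = 0.
Proof.
under eq_bigr do rewrite drift_uncond.
set S := LHS; suff : S = - S by lra.
rewrite {1}/S exchange_big -sumrN; apply: eq_bigr => i _; rewrite -sumrN.
by apply: eq_bigr => j _; rewrite weight_symT; ring.
Qed.

(** By symmetry the left-hand side is minus half of the Dirichlet form
[\sum_(i, j) psi i j * (a j - a i)^2], which [sqr_drift_le] bounds from below. *)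
Lemma drift_dissipation (a : 'I_N -> R) :
  \sum_(i < N) a i * (\sum_(j < N | j != i) psi i j * (a j - a i)) <=
  - (1 / 2) * \sum_(i < N) (\sum_(j < N | j != i) psi i j * (a j - a i)) ^+ 2.
Proof.
have -> : \sum_(i < N) a i * (\sum_(j < N | j != i) psi i j * (a j - a i)) =
    - (1 / 2) * \sum_(i < N) \sum_(j < N | j != i) psi i j * (a j - a i) ^+ 2.
  have -> : \sum_(i < N) \sum_(j < N | j != i) psi i j * (a j - a i) ^+ 2 =
      \sum_(i < N) \sum_(j < N) psi i j * (a j - a i) ^+ 2.
    by apply: eq_bigr => i _; rewrite [RHS](bigD1 i)//= subrr expr0n mulr0 add0r.
  under eq_bigr do rewrite drift_uncond mulr_sumr.
  set S := LHS.
  have S2 : S = \sum_(i < N) \sum_(j < N) psi i j * (a i - a j) * a j.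
    rewrite /S exchange_big; apply: eq_bigr => i _; apply: eq_bigr => j _.
    by rewrite weight_symT; ring.
  have : S + S = - \sum_(i < N) \sum_(j < N) psi i j * (a j - a i) ^+ 2; last by lra.
  rewrite {2}S2 /S -big_split/= -sumrN; apply: eq_bigr => i _.
  by rewrite -big_split/= -sumrN; apply: eq_bigr => j _; ring.
by rewrite !mulNr lerN2 ler_pM2l//; apply: ler_sum => i _; exact: sqr_drift_le.
Qed.

End WeightMatrix.

(** * The scalar delayed system *)

Definition drift (R : realType) (N : nat) (tau : R) (psi : 'I_N -> 'I_N -> R -> R)
    (y : 'I_N -> R -> R) (i : 'I_N) (t : R) : R :=
  \sum_(j < N | j != i) psi i j t * (y j (t - tau) - y i (t - tau)).

Lemma drift_continuous (R : realType) (N : nat) (tau : R)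
    (psi : 'I_N -> 'I_N -> R -> R) (y : 'I_N -> R -> R) (t : R) :
  (forall i j, i != j -> {for t, continuous (psi i j)}) ->
  (forall i, {for t - tau, continuous (y i)}) ->
  forall i, {for t, continuous (drift tau psi y i)}.
Proof.
move=> psic yc i; rewrite /prop_for /continuous_at.
have yc' k : (fun s => y k (s - tau)) @ t --> y k (t - tau).
  apply: (@continuous_comp _ _ _ (fun s => s - tau) (y k)); last exact: yc.
  by apply: cvgB; [exact: cvg_id|exact: cvg_cst].
apply: (cvg_big (op := +%R)) => [|j ji]; first exact: add_continuous; apply: cvgM; first by apply: psic; rewrite eq_sym.
by apply: cvgB.
Qed.

Lemma driftN (R : realType) (N : nat) (tau : R)
    (psi : 'I_N -> 'I_N -> R -> R) (y : 'I_N -> R -> R) i t :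
  drift tau psi (fun i s => - y i s) i t = - drift tau psi y i t.
Proof. by rewrite /drift -sumrN; apply: eq_bigr => j _; ring. Qed.

(** The equation satisfied by one coordinate of all agents, at interior times
only, where continuity and derivatives are two-sided. *)
Definition scalar_solution (R : realType) (N : nat) (tau : R)
    (psi : 'I_N -> 'I_N -> R -> R) (y : 'I_N -> R -> R) : Prop :=
  (forall i (t : R), - tau < t -> {for t, continuous (y i)}) /\
  (forall i (t : R), 0 < t -> is_derive t 1 (y i) (drift tau psi y i t)).

Lemma scalar_solutionN (R : realType) (N : nat) (tau : R)
    (psi : 'I_N -> 'I_N -> R -> R) (y : 'I_N -> R -> R) :
  scalar_solution tau psi y -> scalar_solution tau psi (fun i t => - y i t).
Proof.
move=> [yc yd]; split=> i t tt; first by apply: cvgN; exact: yc.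
by rewrite driftN; apply: is_deriveN; exact: yd.
Qed.

(** * Maximum principle *)

Lemma eventually_all_index (R : realType) (N : nat) (b : R) (P : 'I_N -> R -> Prop) :
  (forall i, exists2 T, b < T & forall t, T <= t -> P i t) ->
  exists2 T, b < T & forall i t, T <= t -> P i t.
Proof.
move=> ex.
have /choice[T TP] i : exists T, b < T /\ forall t, T <= t -> P i t.
  by have [T bT PT] := ex i; exists T.
exists (\big[Num.max/(b + 1)]_(i < N) T i).
  by apply: lt_le_trans (bigmax_ge_id _ _ _ _); rewrite ltrDl.
by move=> i t Tt; apply: (TP i).2; apply: le_trans Tt; exact: le_bigmax.
Qed.

(** Maximum principle for trajectories that asymptotically do not exceed their
mean over the preceding delay window; [m] is the conserved mean of the agents. *)
Lemma eventually_le_mean (R : realType) (N : nat) (tau : R)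
    (psi : 'I_N -> 'I_N -> R -> R) (y Y : 'I_N -> R -> R) (b kappa m B : R) :
  (2 <= N)%N -> 0 < tau -> 0 < kappa ->
  (forall i (t : R), b < t -> \sum_(j < N | j != i) psi i j t <= 1) ->
  (forall i j (t : R), i != j -> b < t -> kappa <= psi i j t) ->
  (forall i (t : R), b < t -> is_derive t 1 (y i) (drift tau psi y i t)) ->
  (forall i (t : R), b < t -> is_derive t 1 (Y i) (y i t)) ->
  (forall i (t : R), b < t -> `|y i t| <= B) ->
  (forall t : R, b < t -> \sum_(i < N) y i t = N%:R * m) ->
  (forall i eps, 0 < eps -> exists2 T, b < T &
    forall t, T <= t -> tau * y i t - (Y i t - Y i (t - tau)) <= eps) ->
  forall eps, 0 < eps -> exists2 T, b < T & forall i t, T <= t -> y i t <= m + eps.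
Proof.
move=> N2 tau0 k0 psiS psik yd Yd yB ym defect.
(* [M], the infimum of the eventual upper bounds, is the limit superior of the
   largest [y i]. *)
pose S := [set c | exists2 T, b < T & forall i t, T <= t -> y i t <= c].
have i0 : 'I_N by exact: Ordinal (ltnW N2).
have S0 : S B.
  exists (b + 1) => [|i t bt]; first by rewrite ltrDl.
  by apply: le_trans (ler_norm _) (yB _ _ _); lra.
have lbS : lbound S (- B).
  move=> c [T bT /(_ i0 T (lexx _))]; apply: le_trans.
  by have := yB i0 T bT; rewrite ler_norml => /andP[].
have infS : has_inf S by split; [exists B|exists (- B)].
pose M := inf S.
have ev eps : 0 < eps -> exists2 T, b < T & forall i t, T <= t -> y i t <= M + eps.
  move=> /inf_adherent-/(_ _ infS)[c [T bT Tc] cM].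
  by exists T => // i t Tt; apply: le_trans (Tc i t Tt) (ltW cM).
have fr eps T : 0 < eps -> b < T -> exists i, exists2 t, T <= t & M - eps < y i t.
  move=> e0 bT; apply: contrapT => H.
  have : S (M - eps).
    exists T => // i t Tt; rewrite leNgt; apply/negP => yt; apply: H.
    by exists i, t.
  by move=> /(ge_inf infS.2); rewrite -/M; lra.
have [Mm|mM] := leP M m.
  by move=> eps /ev[T bT HT]; exists T => // i t Tt; apply: le_trans (HT i t Tt) _; lra.
exfalso; set gam := M - m; have gam0 : 0 < gam by rewrite /gam; lra.
have N0 : 0 < N%:R :> R by rewrite ltr0n ltnW.
(* [eps] is chosen so that the total pull [q / 2] on [y i] over half a delay
   exceeds [eps * den], the sum of the errors collected below. *)
pose q := kappa * N%:R * gam * tau.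
have q0 : 0 < q by rewrite !mulr_gt0.
pose den := 2 + 7 * (1 + kappa) * tau.
have den0 : 0 < den by have := mulr_gt0 k0 tau0; rewrite /den; lra.
pose eps := q / (4 * den).
have e0 : 0 < eps by rewrite divr_gt0// mulr_gt0.
have epsE : eps * den = q / 4 by rewrite /eps; field; rewrite gt_eqF.
have et0 : 0 < eps * tau by exact: mulr_gt0.
have [T1 bT1 HT1] := ev _ e0.
have [T2 bT2 HT2] := eventually_all_index (fun i => defect i _ et0).
have bT : b < Num.max T1 T2 + 3 * tau by rewrite ltr_pwDr ?mulr_gt0// ltW// lt_max bT1.
have [i [t Tt yt]] := fr _ _ e0 bT.
have t1 : T1 + 3 * tau <= t by apply: le_trans Tt; rewrite lerD2r le_max lexx.
have t2 : T2 + 3 * tau <= t by apply: le_trans Tt; rewrite lerD2r le_max lexx orbT.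
(* The gap to the almost upper bound [M + eps] is nonnegative at late times, so
   its primitive [Gam] is nondecreasing there. *)
pose g j s := M + eps - y j s.
have g0 j s : T1 <= s -> 0 <= g j s by move=> Ts; rewrite subr_ge0; exact: HT1.
pose Gam s := (M + eps) * s - Y i s.
have Gamd s : b < s -> is_derive s 1 Gam (g i s).
  move=> bs; rewrite /g -[M + eps]mulr1.
  by exact: (is_derive_subf (is_derive_scalef _ (is_derive_idf _)) (Yd i _ bs)).
have Gam_mono s u : T1 <= s -> s <= u -> Gam s <= Gam u.
  move=> Ts su; apply: (derive_ge0_le su (df := g i)) => x /andP[sx _].
    by apply: Gamd; lra.
  by apply: g0; lra.
have window s : T2 <= s -> Gam s - Gam (s - tau) <= tau * g i s + eps * tau.
  by move=> Ts; have := HT2 i s Ts; rewrite /Gam /g; lra.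
(* A time [x] with a small gap in the first half of the window: the windows
   ending at [x] and at [t] together reach back to [t - 3 * tau / 2]. *)
have [x /andP[x1 x2] gx] : exists2 x, t - tau < x < t - tau / 2 &
    Gam (t - tau / 2) - Gam (t - tau) = g i x * (t - tau / 2 - (t - tau)).
  apply: MVT_closed; first by lra.
  by move=> s /andP[ts _]; apply: Gamd; lra.
have gx6 : g i x * tau <= 6 * eps * tau.
  have w := window t ltac:(lra).
  have := Gam_mono (t - tau / 2) t ltac:(lra) ltac:(lra).
  have : tau * g i t <= tau * (2 * eps) by rewrite ler_pM2l// /g; lra.
  by move: gx w; lra.
have Gx : Gam (t - tau) - Gam (t - tau / 2 - tau) <= 7 * eps * tau.
  have w := window x ltac:(lra).
  have := Gam_mono (t - tau) x ltac:(lra) ltac:(lra).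
  have := Gam_mono (x - tau) (t - tau / 2 - tau) ltac:(lra) ltac:(lra).
  by lra.
have drift_le u : t - tau / 2 <= u <= t ->
    drift tau psi y i u <= (1 + kappa) * g i (u - tau) - kappa * N%:R * gam.
  move=> /andP[tu ut].
  have -> : drift tau psi y i u =
      g i (u - tau) * (\sum_(j < N | j != i) psi i j u) -
      \sum_(j < N | j != i) psi i j u * g j (u - tau).
    by rewrite mulr_sumr -sumrB; apply: eq_bigr => j _; rewrite /g; ring.
  have gi0 : 0 <= g i (u - tau) by apply: g0; lra.
  have := ler_wpM2l gi0 (psiS i u ltac:(lra)).
  have : \sum_(j < N | j != i) kappa * g j (u - tau) <=
      \sum_(j < N | j != i) psi i j u * g j (u - tau).
    apply: ler_sum => j ji; apply: ler_wpM2r; first by apply: g0; lra.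
    by apply: psik; rewrite 1?eq_sym//; lra.
  have : \sum_(j < N) kappa * g j (u - tau) =
      kappa * g i (u - tau) + \sum_(j < N | j != i) kappa * g j (u - tau).
    by rewrite (bigD1 i).
  have : kappa * N%:R * gam <= \sum_(j < N) kappa * g j (u - tau).
    rewrite -mulr_sumr sumrB sumr_const card_ord ym; last by lra.
    rewrite -mulrA ler_pM2l// -[(M + eps) *+ N]mulr_natl -mulrBr ler_pM2l// /gam; lra.
  by lra.
pose phi u := y i u - (1 + kappa) * Gam (u - tau) + kappa * N%:R * gam * u.
have : phi t <= phi (t - tau / 2).
  apply: (@derive_le0_ge _ phi (fun u => drift tau psi y i u -
    (1 + kappa) * g i (u - tau) + kappa * N%:R * gam * 1)).
  - lra.
  - move=> u /andP[tu _]; have [b1 b2] : b < u /\ b < u - tau by split; lra.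
    exact: (is_derive_addf (is_derive_subf (yd i _ b1)
      (is_derive_scalef _ (is_derive_shiftf (Gamd _ b2))))
      (is_derive_scalef _ (is_derive_idf _))).
  - by move=> u /drift_le; lra.
have : y i (t - tau / 2) <= M + eps by apply: HT1; lra.
have := ler_wpM2l (ltac:(lra) : 0 <= 1 + kappa) Gx.
move: epsE q0; rewrite /phi /den /q; lra.
Qed.

(** * Energy and consensus for scalar trajectories *)

Definition admissible_weights (R : realType) (N : nat)
    (psi : 'I_N -> 'I_N -> R -> R) : Prop :=
  [/\ (forall i j (t : R), i != j -> 0 < t -> {for t, continuous (psi i j)}),
      (forall i j (t : R), i != j -> 0 < t -> 0 <= psi i j t),
      (forall i j (t : R), i != j -> 0 < t -> psi i j t <= 1 / (N%:R - 1)) &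
      (forall i j (t : R), i != j -> 0 < t -> psi i j t = psi j i t)].

(** The Lyapunov functional.  The times after [3 * tau] leave room for the two
successive primitives [G] and [H] of [v ^+ 2] to be shifted by [tau] while
staying in the region where the equation and the primitives are valid. *)
Lemma energy_exists (R : realType) (N : nat) (tau : R)
    (psi : 'I_N -> 'I_N -> R -> R) (y : 'I_N -> R -> R) :
  (2 <= N)%N -> 0 < tau -> tau <= 1 / 2 -> admissible_weights psi ->
  scalar_solution tau psi y ->
  exists E e : R -> R, forall t : R, 3 * tau < t ->
    [/\ is_derive t 1 E (e t),
        forall i, y i t ^+ 2 <= 2 * E t &
        forall i, (2 * tau)^-1 *
          (tau * drift tau psi y i t - (y i t - y i (t - tau))) ^+ 2 <= - e t].
Proof.
move=> N2 tau0 tau_le [psic psi0 psi1 psis] [yc yd].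
set v := drift tau psi y in yd *.
have vc i (t : R) : 0 < t -> {for t, continuous (fun s => v i s ^+ 2)}.
  move=> t0; apply: (@continuous_comp _ _ _ (v i) (fun x => x ^+ 2)).
    apply: drift_continuous => [j k jk|j]; first exact: psic.
    by apply: yc; lra.
  exact: exprn_continuous.
have /choice[G Gd] i : exists Gi : R -> R, forall t, tau < t ->
    is_derive t 1 Gi (v i t ^+ 2) by exact: primitive_exists tau0 (vc i).
have tau2 : tau < 2 * tau by lra.
have /choice[H Hd] i : exists Hi : R -> R, forall t, 2 * tau < t ->
    is_derive t 1 Hi (G i t).
  by apply: primitive_exists tau2 _ => t ttau; exact: is_derive_cont (Gd i t ttau).
have Gmono i s t : tau < s -> s <= t -> G i s <= G i t.
  move=> ts st; apply: (derive_ge0_le st (df := fun u => v i u ^+ 2)) => u /andP[su _].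
    by apply: Gd; exact: lt_le_trans su.
  exact: sqr_ge0.
(* [W i] is half the double integral of [v i ^+ 2] over the delay window. *)
pose W i t := 1 / 2 * (tau * G i t - (H i t - H i (t - tau))).
pose w i t := 1 / 2 * (tau * v i t ^+ 2 - (G i t - G i (t - tau))).
have W_ge0 i t : 3 * tau < t -> 0 <= W i t.
  move=> tt; have Hd' u : t - tau <= u <= t -> is_derive u 1 (H i) (G i u).
    by move=> /andP[tu _]; apply: Hd; lra.
  have tt' : t - tau < t by lra.
  have [x /andP[sx xt] HE] := MVT_closed tt' Hd'.
  have tx : tau < x by lra.
  have := ler_wpM2l (ltW tau0) (Gmono i _ _ tx (ltW xt)).
  by rewrite /W HE; lra.
pose r i t := tau * v i t - (y i t - y i (t - tau)).
exists (fun t => \sum_(i < N) (1 / 2 * y i t ^+ 2 + W i t)).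
exists (fun t => \sum_(i < N) (1 / 2 * (2 * y i t * v i t) + w i t)) => t tt.
have t0 : 0 < t by lra.
split.
- apply: is_derive_sumf => i.
  have [t1 t2 t3 t4] : [/\ tau < t, 2 * tau < t, 2 * tau < t - tau & 0 < t] by split; lra.
  exact: (is_derive_addf (is_derive_scalef _ (is_derive_sqrf (yd i _ t4)))
    (is_derive_scalef _ (is_derive_subf (is_derive_scalef _ (Gd i _ t1))
      (is_derive_subf (Hd i _ t2) (is_derive_shiftf (Hd i _ t3)))))).
- move=> i; rewrite (bigD1 i)//=.
  have := W_ge0 i t tt.
  have : 0 <= \sum_(j < N | j != i) (1 / 2 * y j t ^+ 2 + W j t).
    apply: sumr_ge0 => j _; have := W_ge0 j t tt; have := sqr_ge0 (y j t); lra.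
  by lra.
- move=> i.
  apply: (@le_trans _ _ (\sum_(j < N) (2 * tau)^-1 * r j t ^+ 2)).
    rewrite (bigD1 i)//= lerDl; apply: sumr_ge0 => j _.
    by rewrite mulr_ge0 ?sqr_ge0// invr_ge0; lra.
  (* Cauchy-Schwarz in the form [z^2 <= tau * (G t - G (t - tau))], completed to
     the square of [r]. *)
  have key j : 1 / 2 * (2 * y j t * v j t) + w j t <=
      y j (t - tau) * v j t + 1 / 2 * v j t ^+ 2 - (2 * tau)^-1 * r j t ^+ 2.
    have tt' : t - tau <= t by lra.
    have yd' u : t - tau <= u <= t -> is_derive u 1 (y j) (v j u).
      by move=> /andP[tu _]; apply: yd; lra.
    have Gd' u : t - tau <= u <= t -> is_derive u 1 (G j) (v j u ^+ 2).
      by move=> /andP[tu _]; apply: Gd; lra.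
    have := sqr_increment_le tt' yd' Gd' (fun u _ => lexx _).
    have -> : t - (t - tau) = tau by ring.
    rewrite -ler_pdivrMl// => CS.
    have -> : (2 * tau)^-1 * r j t ^+ 2 = 1 / 2 * (tau * v j t ^+ 2)
        - v j t * (y j t - y j (t - tau))
        + 1 / 2 * (tau^-1 * (y j t - y j (t - tau)) ^+ 2).
      by rewrite /r; field; rewrite gt_eqF.
    have := ler_wpM2r (sqr_ge0 (v j t)) tau_le; rewrite /w; lra.
  rewrite lerNr; apply: le_trans (ler_sum _ (fun j _ => key j)) _.
  rewrite sumrB big_split/=.
  have /= := @drift_dissipation R N (fun j k => psi j k t) N2 _ _ _ (fun j => y j (t - tau)).
  move=> /(_ (fun j k jk => psi0 j k t jk t0) (fun j k jk => psi1 j k t jk t0)).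
  move=> /(_ (fun j k jk => psis j k t jk t0)).
  rewrite -/(v _) -mulr_sumr; rewrite /v /drift; lra.
Qed.

(** The energy is nonincreasing, hence bounded by its value at [4 * tau], a time
at which the conclusions of [energy_exists] hold. *)
Lemma scalar_solution_bounded (R : realType) (N : nat) (tau : R)
    (psi : 'I_N -> 'I_N -> R -> R) (y : 'I_N -> R -> R) :
  (2 <= N)%N -> 0 < tau -> tau <= 1 / 2 -> admissible_weights psi ->
  scalar_solution tau psi y ->
  exists B : R, forall i t, 4 * tau < t -> `|y i t| <= B.
Proof.
move=> N2 tau0 tau_le adm ysol.
have [E [e Ee]] := energy_exists N2 tau0 tau_le adm ysol.
exists (Num.sqrt (2 * E (4 * tau))) => i t tt.
have [_ yE _] := Ee t ltac:(lra).
rewrite -sqrtr_sqr; apply: ler_wsqrtr; apply: le_trans (yE i) _; rewrite ler_pM2l//.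
apply: (derive_le0_ge (ltW tt) (df := e)) => u /andP[tu _].
  by have [] := Ee u ltac:(lra).
have [_ _ /(_ i)] := Ee u ltac:(lra).
move=> H; rewrite -oppr_ge0; apply: le_trans H.
by rewrite mulr_ge0 ?sqr_ge0// invr_ge0; lra.
Qed.

(** The sum of the agents is conserved, so its value at [4 * tau], the time from
which the trajectories are bounded, determines the mean in the maximum
principle. *)
Lemma eventually_le_average (R : realType) (N : nat) (tau kappa : R)
    (psi : 'I_N -> 'I_N -> R -> R) (y : 'I_N -> R -> R) :
  (2 <= N)%N -> 0 < tau -> tau <= 1 / 2 -> admissible_weights psi ->
  0 < kappa -> (forall i j (t : R), i != j -> 0 < t -> kappa <= psi i j t) ->
  scalar_solution tau psi y ->
  forall eps, 0 < eps -> exists T, forall i t, T <= t ->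
    y i t <= (\sum_(j < N) y j (4 * tau)) / N%:R + eps.
Proof.
move=> N2 tau0 tau_le adm k0 psik ysol eps eps0.
have [[_ _ psi1 psis] [_ yd]] := (adm, ysol).
have [E [e Ee]] := energy_exists N2 tau0 tau_le adm ysol.
have [B yB] := scalar_solution_bounded N2 tau0 tau_le adm ysol.
have b0 : 0 < 4 * tau by rewrite mulr_gt0.
have N0 : 0 < N%:R :> R by rewrite ltr0n ltnW.
have /choice[Y Yd] i : exists Yi : R -> R, forall t, 4 * tau < t ->
    is_derive t 1 Yi (y i t).
  by apply: primitive_exists b0 _ => t t0; exact: is_derive_cont (yd i t t0).
set m := _ / _.
have ym (t : R) : 4 * tau < t -> \sum_(i < N) y i t = N%:R * m.
  move=> tt; rewrite /m mulrC divfK ?gt_eqF//.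
  have Sd u : 4 * tau <= u <= t -> is_derive u 1 (fun s => \sum_(i < N) y i s) 0.
    move=> /andP[tu _]; have u0 : 0 < u by lra.
    apply: is_derive_eq (is_derive_sumf (fun i => yd i u u0)) _.
    exact: (sum_drift_eq0 (fun i j ij => psis i j u ij u0) (fun i => y i (u - tau))).
  by apply/le_anti/andP; split;
    [apply: (derive_le0_ge (ltW tt) Sd)|apply: (derive_ge0_le (ltW tt) Sd)].
have [T _ HT] : exists2 T, 4 * tau < T & forall i t, T <= t -> y i t <= m + eps.
  apply: (@eventually_le_mean R N tau psi y Y (4 * tau) kappa m B) => //.
  - move=> i t tt; apply: (weight_sum_le1 N2 (psi := fun i j => psi i j t)) => j k jk.
    by apply: psi1 => //; lra.
  - by move=> i j t ij tt; apply: psik => //; lra.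
  - by move=> i t tt; apply: yd; lra.
  move=> i; apply: (@window_mean_defect_le R (y i) (Y i) (drift tau psi y i) E e
    tau (4 * tau) (2 * tau)^-1 B) => //.
  - by rewrite invr_gt0 mulr_gt0.
  - by move=> t tt; apply: yd; lra.
  - by move=> t tt; exact: yB.
  - by move=> t tt; have [] := Ee t ltac:(lra).
  - move=> t tt; have [_ /(_ i) H _] := Ee t ltac:(lra).
    by have := sqr_ge0 (y i t); lra.
  - by move=> t tt; have [_ _ H] := Ee t ltac:(lra); exact: H.
by exists T.
Qed.

Lemma eventually_close (R : realType) (N : nat) (tau kappa : R)
    (psi : 'I_N -> 'I_N -> R -> R) (y : 'I_N -> R -> R) :
  (2 <= N)%N -> 0 < tau -> tau <= 1 / 2 -> admissible_weights psi ->
  0 < kappa -> (forall i j (t : R), i != j -> 0 < t -> kappa <= psi i j t) ->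
  scalar_solution tau psi y ->
  forall eps, 0 < eps -> exists T, forall i j t, T <= t -> `|y i t - y j t| <= eps.
Proof.
move=> N2 tau0 tau_le adm k0 psik ysol eps eps0.
have e2 : 0 < eps / 2 by rewrite divr_gt0.
have [T1 H1] := eventually_le_average N2 tau0 tau_le adm k0 psik ysol e2.
have [T2 H2] := eventually_le_average N2 tau0 tau_le adm k0 psik
  (scalar_solutionN ysol) e2.
exists (Num.max T1 T2) => i j t; rewrite ge_max => /andP[t1 t2].
have := H2 i t t2; have := H2 j t t2; have := H1 i t t1; have := H1 j t t1.
by rewrite sumrN mulNr ler_norml; set m := _ / _; lra.
Qed.

(** * Euclidean distances and coordinates *)

Lemma enorm_le (R : realType) (d : nat) (v : 'rV[R]_d) (delta : R) :
  0 <= delta -> (forall k, `|v ord0 k| <= delta) -> enorm v <= d%:R * delta.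
Proof.
move=> d0 vd; rewrite /enorm.
have D0 : 0 <= d%:R * delta by rewrite mulr_ge0.
rewrite -(ger0_norm D0) -sqrtr_sqr; apply: ler_wsqrtr.
apply: (@le_trans _ _ (\sum_(k < d) delta ^+ 2)).
  by apply: ler_sum => k _; rewrite -[v ord0 k ^+ 2]real_normK ?num_real// lerXn2r ?nnegrE.
rewrite sumr_const card_ord -[delta ^+ 2 *+ d]mulr_natl exprMn; apply: ler_wpM2r; first exact: sqr_ge0.
by rewrite -natrX ler_nat; case: d {v vd D0} => // n; rewrite expnS expn1 leq_pmulr.
Qed.

Lemma diameter_le (R : realType) (N d : nat) (x : 'I_N -> R -> 'rV[R]_d) (t C : R) :
  0 <= C -> (forall i j, enorm (x i t - x j t) <= C) -> diameter x t <= C.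
Proof.
move=> C0 xC; apply: bigmax_le => // i _; apply: bigmax_le => // j _; exact: xC.
Qed.

Lemma diameter_ge0 (R : realType) (N d : nat) (x : 'I_N -> R -> 'rV[R]_d) (t : R) :
  0 <= diameter x t.
Proof. exact: bigmax_ge_id. Qed.

Lemma is_derive_coord (R : realType) (d : nat) (f : R -> 'rV[R]_d) (t : R)
    (df : 'rV[R]_d) (k : 'I_d) :
  is_derive t 1 f df -> is_derive t 1 (fun s => f s ord0 k) (df ord0 k).
Proof.
move=> [fd <-]; have fk := (derivable_mxP f t 1).1 fd ord0 k.
by apply: (DeriveDef fk); rewrite derive_mx// mxE.
Qed.

Lemma within_ray_continuous_at (R : realType) (V : normedModType R) (a t : R)
    (f : R -> V) :
  {within `[a, +oo[, continuous f} -> a < t -> {for t, continuous f}.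
Proof.
move=> fc at_; apply: (@within_continuous_continuous _ _ _ a (t + 1)).
- by rewrite (lt_trans at_)// ltrDl.
- apply: continuous_subspaceW fc => s /=; rewrite !in_itv/= andbT.
  by case/andP.
- by rewrite in_itv/= at_ ltrDl ltr01.
Qed.

Lemma segment_bounded (R : realType) (f : R -> R) (p q : R) : p <= q ->
  {within `[p, q], continuous f} ->
  exists C, forall t, p <= t <= q -> `|f t| <= C.
Proof.
move=> pq fc; have [c _ fcmax] := EVT_max pq fc; have [c' _ fcmin] := EVT_min pq fc.
exists (Num.max (f c) (- f c')) => t tpq.
have tin : t \in `[p, q] by rewrite in_itv.
rewrite ler_norml lerNl !le_max lerN2 (fcmax _ tin) (fcmin _ tin) orbT.
by [].
Qed.

Theorem theorem3 (R : realType) (N d : nat) (tau : R)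
  (psi : 'I_N -> 'I_N -> R -> R) (x0 x : 'I_N -> R -> 'rV[R]_d)
  (hN : (2 <= N)%N) (hd : (1 <= d)%N) (htau : 0 < tau)
  (hx0 : forall i : 'I_N, {within `[- tau, 0], continuous (x0 i)})
  (hpsi_cont : forall i j : 'I_N, i != j ->
     {within `[0, +oo[, continuous (psi i j)})
  (hpsi_ge0 : forall (i j : 'I_N) (t : R), i != j -> 0 <= t -> 0 <= psi i j t)
  (hpsi_le : forall (i j : 'I_N) (t : R), i != j -> 0 <= t ->
     psi i j t <= 1 / (N%:R - 1))
  (hpsi_sym : forall (i j : 'I_N) (t : R), i != j -> 0 <= t ->
     psi i j t = psi j i t)
  (hx : is_solution tau psi x0 x)
  (hpsi_pos : globally_positive tau psi x)
  (htau_le : tau <= 1 / 2) :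
  diameter x t @[t --> +oo] --> (0 : R).
Proof.
case: hx => xc _ xd _.
have N1 : 0 < N%:R - 1 :> R by rewrite subr_gt0 ltr1n.
have adm : admissible_weights psi.
  split=> i j t ij t0.
  - exact: (@within_ray_continuous_at R R 0 t _ (hpsi_cont i j ij)).
  - exact: hpsi_ge0 (ltW t0).
  - exact: hpsi_le (ltW t0).
  - exact: hpsi_sym (ltW t0).
pose y k i t := x i t ord0 k.
have yw k i : {within `[- tau, +oo[, continuous (y k i)}.
  move=> s; apply: (@continuous_comp _ _ _ (x i : subspace `[- tau, +oo[ -> _)
    (fun M : 'rV[R]_d => M ord0 k)); first exact: xc.
  exact: coord_continuous.
have yc k i (t : R) : - tau < t -> {for t, continuous (y k i)}.
  exact: (@within_ray_continuous_at R R _ t _ (yw k i)).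
have yd k i (t : R) : 0 < t -> is_derive t 1 (y k i) (drift tau psi (y k) i t).
  move=> t0; have -> : drift tau psi (y k) i t = (\sum_(j < N | j != i)
      psi i j t *: (x j (t - tau) - x i (t - tau))) ord0 k.
    by rewrite summxE; apply: eq_bigr => j _; rewrite !mxE.
  by apply: is_derive_coord; exact: xd.
have ysol k : scalar_solution tau psi (y k) by split=> i t; [exact: yc|exact: yd].
have y_bounded k i : exists C, forall t, - tau <= t -> `|y k i t| <= C.
  have [B yB] := scalar_solution_bounded hN htau htau_le adm (ysol k).
  have [||C yC] := @segment_bounded R (y k i) (- tau) (4 * tau).
  - lra.
  - apply: continuous_subspaceW (yw k i) => s /=; rewrite !in_itv/= andbT.
    by case/andP.
  exists (Num.max B C) => t tt; rewrite le_max.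
  by have [t4|t4] := leP t (4 * tau); rewrite ?(yB i t t4)// (yC t) ?orbT// tt.
have /choice[C yC] (ki : 'I_d * 'I_N) :
    exists C, forall t, - tau <= t -> `|y ki.1 ki.2 t| <= C.
  exact: y_bounded.
pose K := \big[Num.max/0]_ki C ki.
have K0 : 0 <= K by exact: bigmax_ge_id.
have yK k i t : - tau <= t -> `|y k i t| <= K.
  by move=> /(yC (k, i)) /le_trans; apply; exact: le_bigmax.
(* Pairwise distances never exceed [r], so the positivity property applies with
   this radius on every time horizon. *)
pose r := d%:R * (2 * K) + 1.
have r0 : 0 < r by rewrite ltr_wpDl// mulr_ge0// mulr_ge0.
have [psi_ psi_0 psi_lb] := hpsi_pos _ r0.
pose kappa := psi_ / (N%:R - 1).
have k0 : 0 < kappa by exact: divr_gt0.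
have psik i j (t : R) : i != j -> 0 < t -> kappa <= psi i j t.
  move=> ij t0; apply: (psi_lb t t0) => //; last by rewrite (ltW t0) lexx.
  move=> s i' j' /andP[ts _]; apply: (@le_trans _ _ (d%:R * (2 * K))); last by rewrite lerDl.
  apply: enorm_le => [|k]; first by rewrite mulr_ge0.
  rewrite !mxE; apply: le_trans (ler_normB _ _) _.
  by have := yK k i' s ts; have := yK k j' s ts; rewrite /y; lra.
apply/cvgrPdist_le => eps eps0.
have d0 : 0 < d%:R :> R by rewrite ltr0n.
have ed0 : 0 < eps / d%:R by exact: divr_gt0.
have /choice[T HT] k : exists T, forall i j t, T <= t -> `|y k i t - y k j t| <= eps / d%:R.
  exact: (eventually_close hN htau htau_le adm k0 psik (ysol k) ed0).
near=> t.
rewrite sub0r normrN ger0_norm ?diameter_ge0//; apply: diameter_le; first exact: ltW.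
move=> i j; have -> : eps = d%:R * (eps / d%:R) by rewrite mulrC divfK ?gt_eqF.
apply: enorm_le => [|k]; first exact: ltW.
rewrite !mxE; apply: HT; apply: (@le_trans _ _ (\big[Num.max/0]_k T k)).
  exact: le_bigmax.
by near: t; apply: nbhs_pinfty_ge; exact: num_real.
Unshelve. all: by end_near. Qed.
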